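(* Let $E$ and $B$ be finite $T_0$-spaces with $E\neq\varnothing$ and let $p\colon E\to B$ be a Hurewicz fibration. Then: (1) If $p$ is minimal, then all path-lifting maps for $p$ are regular. (2) If $p$ does not have down beat points, then there exists a regular path-lifting map for $p$.
   Context: A finite $T_0$-space $X$ is regarded as a poset via $x\leq y$ iff $U_x\subseteq U_y$, where $U_a$ is the smallest open set containing $a$. Put $\widehat U_a=\{x: x<a\}$ and $\widehat F_a=\{x: x>a\}$. A point $a$ is a down beat point of $X$ if $\widehat U_a$ has a maximum element, and an up beat point of $X$ if $\widehat F_a$ has a minimum element. For a continuous map $p\colon E\to B$ between finite $T_0$-spaces, a point $e\in E$ is a down (resp. up) beat point of $p$ if it is a down (resp. up) beat point of both $E$ and the fiber $p^{-1}(p(e))$ (with the subspace topology); a beat point of $p$ is a down or up beat point of $p$. The map $p$ is minimal if it does not have beat points. A Hurewicz fibration is a continuous map with the homotopy lifting property with respect to all topological spaces. Let $I=[0,1]$ with the usual topology, let path spaces $B^I,E^I$ have the compact-open topology, and let $E\times_p B^I=\{(e,\gamma)\in E\times B^I: \gamma(0)=p(e)\}$. A path-lifting map for $p$ is a continuous map $\Lambda\colon E\times_p B^I\to E^I$ such that $\Lambda(e,\gamma)(0)=e$ and $p\circ\Lambda(e,\gamma)=\gamma$ for all $(e,\gamma)$. It is regular if it lifts constant paths to constant paths, i.e. $\Lambda(e,\gamma)$ is the constant path at $e$ whenever $\gamma$ is the constant path at $p(e)$. *)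

(* Defs.v *)
From HB Require Import structures.
From mathcomp Require Import all_boot all_order all_algebra finmap.
From mathcomp Require Import boolp classical_sets functions cardinality.
From mathcomp Require Import set_interval filter reals topology normedtype.

Set Implicit Arguments.
Unset Strict Implicit.
Unset Printing Implicit Defensive.

Import Order.TTheory GRing.Theory Num.Theory.
Import numFieldNormedType.Exports.
(* Equips [continuousType U V] with the compact-open topology. *)
Export ArrowAsCompactOpen.

Local Open Scope classical_set_scope.
Local Open Scope ring_scope.

Definition finite_T0_space (X : topologicalType) : Prop :=
  finite_set [set: X] /\ kolmogorov_space X.

Section FiniteSpaces.
Context {X : topologicalType}.
Implicit Types a x y : X.

(* The intersection of all open sets containing [a]: in a finite space it is
   itself open ([open_minopen]), hence the smallest such set. *)
Definition minopen a : set X := smallest open [set a].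

Lemma minopenP a x :
  minopen a x <-> forall U : set X, open U -> U a -> U x.
Proof.
split=> [h U oU Ua|h U [oU aU]]; last exact: h oU (aU a erefl).
by apply: h; split=> // y ->.
Qed.

Lemma open_minopen a : finite_set [set: X] -> open (minopen a).
Proof.
move=> /finite_fsetP[D eD].
have cvx x : exists U : set X, [/\ open U, U a & U x -> minopen a x].
  have [ax|nax] := pselect (minopen a x).
    by exists setT; split=> //; exact: openT.
  apply: contrapT => nU; apply: nax; apply/minopenP => U oU Ua.
  by apply: contrapT => nUx; apply: nU; exists U.
have [F hF] := choice cvx.
rewrite openE => z /minopenP az.
have : nbhs z (\bigcap_(x in [set` D]) F x).
  apply: filter_bigI => x _; have [oF Fa _] := hF x.
  by apply: open_nbhs_nbhs; split=> //; exact: az.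
apply: filterS => y Fy; have [_ _] := hF y; apply; apply: Fy.
by rewrite -eD.
Qed.

Definition space_le x y : Prop := minopen x `<=` minopen y.

Definition space_lt x y : Prop := space_le x y /\ x <> y.

Lemma space_le_anti x y :
  kolmogorov_space X -> space_le x y -> space_le y x -> x = y.
Proof.
have nle u v A : A \in nbhs u -> v \in ~` A -> ~ space_le v u.
  rewrite !inE /= nbhsE => -[O [oO Ou] OA] nAv vu.
  have /vu/minopenP/(_ O oO Ou)/OA // : minopen v v by exact/minopenP.
move=> T0 xy yx; apply: contrapT => /eqP/T0[A [[Ax Ay]|[Ay Ax]]].
- exact: nle Ax Ay yx.
- exact: nle Ay Ax xy.
Qed.

Definition Uhat a : set X := [set x | space_lt x a].

Definition Fhat a : set X := [set x | space_lt a x].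

Definition has_maximum (S : set X) : Prop :=
  exists2 m, S m & forall x, S x -> space_le x m.

Definition has_minimum (S : set X) : Prop :=
  exists2 m, S m & forall x, S x -> space_le m x.

Definition down_beat_point a : Prop := has_maximum (Uhat a).

Definition up_beat_point a : Prop := has_minimum (Fhat a).

End FiniteSpaces.

Section BeatPointsOfMaps.
Context {E B : topologicalType} (p : E -> B).

(* As a type, a set carries the subspace topology. *)
Definition fiber (b : B) : set E := p @^-1` [set b].

Definition fiber_pt (e : E) : fiber (p e) :=
  exist _ e (mem_set (erefl : fiber (p e) e)).

Definition map_down_beat_point (e : E) : Prop :=
  down_beat_point e /\ down_beat_point (fiber_pt e).

Definition map_up_beat_point (e : E) : Prop :=
  up_beat_point e /\ up_beat_point (fiber_pt e).

Definition map_beat_point (e : E) : Prop :=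
  map_down_beat_point e \/ map_up_beat_point e.

Definition minimal_map : Prop := forall e, ~ map_beat_point e.

End BeatPointsOfMaps.

Section Fibrations.
Context (R : realType).

Definition unit_interval : set R := `[0, 1].

Lemma unit_interval0 : unit_interval 0.
Proof. by rewrite /unit_interval /= in_itv /= lexx ler01. Qed.

Definition I0 : unit_interval := exist _ 0 (mem_set unit_interval0).

Definition hurewicz_fibration (E B : topologicalType) (p : E -> B) : Prop :=
  continuous p /\
  forall (X : topologicalType) (f : X -> E) (H : X * unit_interval -> B),
    continuous f -> continuous H -> (forall x, H (x, I0) = p (f x)) ->
    exists G : X * unit_interval -> E,
      [/\ continuous G, forall x, G (x, I0) = f x & forall z, p (G z) = H z].

Definition path_space (X : topologicalType) : topologicalType :=
  continuousType unit_interval X.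

Definition lifting_data (E B : topologicalType) (p : E -> B) :
    set (E * path_space B) :=
  [set eg : E * path_space B | eg.2 I0 = p eg.1].

Definition path_lifting_map (E B : topologicalType) (p : E -> B)
    (L : lifting_data p -> path_space E) : Prop :=
  continuous L /\
  forall z : lifting_data p,
    L z I0 = (set_val z).1 /\ p \o L z = (set_val z).2.

Definition regular_lifting (E B : topologicalType) (p : E -> B)
    (L : lifting_data p -> path_space E) : Prop :=
  forall z : lifting_data p,
    (set_val z).2 = cst (p (set_val z).1) :> (unit_interval -> B) ->
    L z = cst (set_val z).1 :> (unit_interval -> E).

End Fibrations.

Arguments unit_interval R : clear implicits.
Arguments lifting_data R {E B} p.

(* Main.v *)
(** Over [p], a continuous [f : E -> E] with [f <= id] is the identity when [p]
    has no down beat points: if [e] is a minimal moved point, every [x < e]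
    satisfies [x = f x <= f e], so [f e] is the maximum of the points below [e],
    in [E] and in the fiber. Dually for [f >= id] and up beat points. Lifting
    constant paths gives a vertical homotopy [h] with [h 0 = id]. As [E] is
    finite, [h s <= h t] for [s] near [t]; hence [h t = id] is an open condition
    without down beat points, and a closed one without up beat points.
    For (1), connectedness of the interval gives [h t = id] for all [t]. For (2),
    openness makes lifts of constant paths constant on some [[0, a]]; lifting up
    to time [a] and then restarting the lifting from the point reached doubles
    [a], and finitely many doublings give a regular path-lifting map. *)
Require Import Defs.
From mathcomp Require Import all_boot all_order all_algebra finmap.
From mathcomp Require Import boolp classical_sets functions cardinality.
From mathcomp Require Import set_interval filter reals topology normedtype.
From mathcomp Require Import lra.

Set Implicit Arguments.
Unset Strict Implicit.
Unset Printing Implicit Defensive.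

Import Order.TTheory GRing.Theory Num.Theory.
Import numFieldNormedType.Exports.

Local Open Scope classical_set_scope.
Local Open Scope ring_scope.

(** * Minimal elements and self-maps of finite posets *)

Lemma finite_minimal (T : choiceType) (lt : T -> T -> Prop) (P : set T) :
  (forall x, ~ lt x x) ->
  (forall x y z, lt x y -> lt y z -> lt x z) ->
  finite_set P -> P !=set0 ->
  exists2 x, P x & forall y, P y -> ~ lt y x.
Proof.
move=> ltxx lt_trans fP [x Px].
(* Induction on the number of elements of [P] below [x]: replacing [x] by some [y] below it drops at
   least [y] from the count. *)
have [n] := ubnP #|` fset_set [set y | P y /\ lt y x]|.
elim: n x Px => // n IH x Px cx.
have [xmin|/existsNP[y /not_implyP[Py /contrapT yx]]] :=
  pselect (forall y, P y -> ~ lt y x); first by exists x.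
apply: (IH y Py); apply: leq_trans (fproper_ltn_card _) cx.
have fs z : finite_set [set y | P y /\ lt y z].
  by apply: sub_finite_set fP => ? [].
rewrite fproperE; apply/andP; split; last apply/negP; rewrite -fset_set_sub//.
  by move=> z [Pz zy]; split=> //; exact: lt_trans zy yx.
by move=> /(_ y) [//|_ /ltxx].
Qed.

(** Points below a minimal moved point are fixed, so monotonicity applies to them. The relation [le]
    is abstract so that it can also be the opposite order. *)
Lemma minimal_moved_point (T : choiceType) (le : T -> T -> Prop) (f : T -> T) :
  finite_set [set: T] ->
  (forall x y z, le x y -> le y z -> le x z) ->
  (forall x y, le x y -> le y x -> x = y) ->
  (forall x y, le x y -> le (f x) (f y)) ->
  f <> id ->
  exists2 x, f x <> x & forall y, le y x -> y <> x -> le y (f x).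
Proof.
move=> finT le_trans le_anti fmono fid.
have [||x fx xmin] := @finite_minimal T (fun x y => le x y /\ x <> y)
    [set x | f x <> x] (fun x h => h.2 erefl) _
    (sub_finite_set (@subsetT _ _) finT) _.
- move=> x y z [xy nxy] [yz nyz]; split; first exact: le_trans xy yz.
  by move=> xz; apply: nxy; apply: le_anti => //; rewrite xz.
- apply: contrapT => nex; apply: fid; apply/funext => x.
  by apply: contrapT => fx; apply: nex; exists x.
exists x => // y yx nyx; have fy : f y = y.
  by apply: contrapT => fy; exact: xmin _ fy (conj yx nyx).
by rewrite -fy; exact: fmono.
Qed.

(** * The order of a space and continuous maps *)

Section SpaceOrder.
Context {X : topologicalType}.
Implicit Types x y : X.

Lemma space_leP x y :
  space_le x y <-> forall U : set X, open U -> U y -> U x.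
Proof.
split=> [xy|xy z /minopenP xz]; last first.
  by apply/minopenP => U oU Uy; apply: xz => //; exact: xy.
by apply/minopenP; apply: (xy x); apply/minopenP.
Qed.

Lemma space_le_trans x y z : space_le x y -> space_le y z -> space_le x z.
Proof. by move=> xy yz; exact: subset_trans xy yz. Qed.

End SpaceOrder.

Lemma space_le_continuous (X Y : topologicalType) (f : X -> Y) x y :
  continuous f -> space_le x y -> space_le (f x) (f y).
Proof.
move=> /continuousP cf /space_leP xy; apply/space_leP => U oU.
exact: xy _ (cf U oU).
Qed.

(** Open sets of a subspace are traces of open sets, so beat points of a fiber can be tested with
    the order of [E]. *)
Lemma space_le_set_val (X : topologicalType) (A : set X) (x y : A) :
  space_le x y <-> space_le (set_val x) (set_val y).
Proof.
split; first by apply: space_le_continuous; exact: initial_continuous.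
move=> /space_leP xy; apply/space_leP => _ [V oV <-] Vy; exact: xy oV Vy.
Qed.

(** Finiteness makes [minopen (f y)] a neighborhood of [f y], and its points are exactly those below
    [f y]. *)
Lemma near_space_le (X Y : topologicalType) (f : Y -> X) (y : Y) :
  finite_set [set: X] -> continuous f -> \forall z \near y, space_le (f z) (f y).
Proof.
move=> finX cf; have nfy : nbhs (f y) (minopen (f y)).
  by apply: open_nbhs_nbhs; split; [exact: open_minopen|exact/minopenP].
have : \forall z \near y, minopen (f y) (f z) by exact: cf nfy.
by apply: filterS => z /minopenP fz; apply/space_leP.
Qed.

(** * Vertical self-maps and vertical homotopies *)

Section VerticalMaps.
Context {E B : topologicalType} (p : E -> B).
Hypotheses (finE : finite_set [set: E]) (T0E : kolmogorov_space E).
Variable f : E -> E.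
Hypotheses (cf : continuous f) (pf : forall e, p (f e) = p e).

Let fiber_lift (e x : E) (pxe : p x = p e) : fiber p (p e) :=
  exist _ x (mem_set (pxe : fiber p (p e) x)).

Lemma vertical_le_id : (forall e, ~ map_down_beat_point p e) ->
  (forall e, space_le (f e) e) -> f = id.
Proof.
move=> nbp fle; apply: contrapT => fid.
have [e fe emax] := minimal_moved_point finE (@space_le_trans E)
  (fun x y => @space_le_anti E x y T0E) (fun x y => space_le_continuous cf) fid.
apply: (nbp e); split.
  by exists (f e) => // x [xe nxe]; exact: emax.
(* As [f] is vertical, [f e] lies in the fiber of [e], where it is again the maximum. *)
exists (fiber_lift (pf e)).
  by split; [apply/space_le_set_val; exact: fle|move=> /(congr1 set_val)].
move=> x [/space_le_set_val xe nxe]; apply/space_le_set_val; apply: emax => // xe'.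
exact/nxe/val_inj.
Qed.

Lemma vertical_ge_id : (forall e, ~ map_up_beat_point p e) ->
  (forall e, space_le e (f e)) -> f = id.
Proof.
move=> nbp fge; apply: contrapT => fid.
have [e fe emin] := @minimal_moved_point E (fun x y => space_le y x) f finE
  (fun x y z xy yz => space_le_trans yz xy)
  (fun x y xy yx => space_le_anti T0E yx xy)
  (fun x y => space_le_continuous cf) fid.
apply: (nbp e); split.
  by exists (f e) => [|x [ex nex]]; [split=> // /esym|apply: emin => // /esym].
exists (fiber_lift (pf e)).
  by split; [apply/space_le_set_val; exact: fge|move=> /(congr1 set_val)/esym].
move=> x [/space_le_set_val ex nex]; apply/space_le_set_val; apply: emin => // ex'.
exact/nex/val_inj/esym.
Qed.

End VerticalMaps.

Section VerticalHomotopies.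
Context {E B T : topologicalType} (p : E -> B) (h : T -> E -> E).
Hypotheses (finE : finite_set [set: E]) (T0E : kolmogorov_space E).
Hypotheses (ch : forall t, continuous (h t))
           (ch' : forall e, continuous (h ^~ e))
           (ph : forall t e, p (h t e) = p e).

(** One neighborhood serves all [e], being an intersection over the finitely many points of [E]. *)
Let near_le t : \forall s \near t, forall e, space_le (h s e) (h t e).
Proof.
have /finite_fsetP[D eD] := finE.
have : \forall s \near t, (\bigcap_(e in [set` D])
    [set s | space_le (h s e) (h t e)]) s.
  by apply: filter_bigI => e _; exact: near_space_le.
by apply: filterS => s Ds e; apply: Ds; rewrite -eD.
Qed.

Lemma open_vertical_id : (forall e, ~ map_down_beat_point p e) ->
  open [set t | h t = id].
Proof.
move=> ndbp; rewrite openE => t /= ht.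
apply: filterS (near_le t) => s; rewrite /= ht.
exact: vertical_le_id.
Qed.

(** The complement is open: if [h s = id] for some [s] near [t], then [id <= h t], which forces
    [h t = id]. *)
Lemma closed_vertical_id : (forall e, ~ map_up_beat_point p e) ->
  closed [set t | h t = id].
Proof.
move=> nubp; rewrite -openC openE => t /= ht.
apply: filterS (near_le t) => s /= hs hsid; apply: ht.
by apply: (@vertical_ge_id _ _ p) => // e; have := hs e; rewrite hsid.
Qed.

End VerticalHomotopies.

(** * Continuity of composites and of maps on products *)

Lemma continuous_compose (X Y Z : topologicalType) (f : X -> Y) (g : Y -> Z) :
  continuous f -> continuous g -> continuous (fun x => g (f x)).
Proof. by move=> cf cg x; exact: continuous_comp (cf x) (cg (f x)). Qed.

Lemma continuous_fst (X Y : topologicalType) : continuous (@fst X Y).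
Proof. by move=> x; exact: cvg_fst. Qed.

Lemma continuous_snd (X Y : topologicalType) : continuous (@snd X Y).
Proof. by move=> x; exact: cvg_snd. Qed.

Lemma continuous_pair (X Y Z : topologicalType) (f : X -> Y) (g : X -> Z) :
  continuous f -> continuous g -> continuous (fun x => (f x, g x)).
Proof. by move=> cf cg x; apply: cvg_pair => /=; [exact: cf|exact: cg]. Qed.

Lemma continuous_section (X Y Z : topologicalType) (f : X * Y -> Z) (x : X) :
  continuous f -> continuous (fun y => f (x, y)).
Proof. by move=> /continuous_curry[_]; exact. Qed.

(** * The unit interval as a retract of the real line *)

Section Clamp.
Context {R : realType}.

Lemma clamp_subproof (s : R) : unit_interval R (Num.max 0 (Num.min s 1)).
Proof.
by rewrite /unit_interval/= in_itv/= le_max lexx ge_max ler01 ge_min lexx orbT.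
Qed.

(** This retraction lets times be added and subtracted as reals, with no membership proofs to
    carry. *)
Definition clamp (s : R) : unit_interval R :=
  exist _ (Num.max 0 (Num.min s 1)) (mem_set (clamp_subproof s)).

Lemma set_val_clamp (s : R) : set_val (clamp s) = Num.max 0 (Num.min s 1).
Proof. by []. Qed.

Lemma unit_interval_val (t : unit_interval R) : 0 <= set_val t <= 1.
Proof. by have := set_valP t; rewrite /unit_interval/= in_itv. Qed.

Lemma set_valK : cancel (set_val : unit_interval R -> R) clamp.
Proof.
move=> t; apply: val_inj => /=; have /andP[t0 t1] := unit_interval_val t.
by rewrite (min_idPl t1) (max_idPr t0).
Qed.

Lemma clamp_le0 (s : R) : s <= 0 -> clamp s = I0 R.
Proof.
move=> s0; apply: val_inj => /=.
by apply/max_idPl; apply: le_trans s0; rewrite ge_min lexx.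
Qed.

Lemma continuous_clamp : continuous clamp.
Proof.
apply: continuous_comp_initial => s.
apply: (@continuous_max R R^o (cst 0) (fun s => Num.min s 1)).
  exact: cvg_cst.
by apply: (@continuous_min R R^o id (cst 1)); [exact: cvg_id|exact: cvg_cst].
Qed.

Lemma clamp_segment : clamp @` `[0, 1] = [set: unit_interval R].
Proof.
apply/seteqP; split=> // t _; exists (set_val t); last exact: set_valK.
exact: set_valP.
Qed.

Lemma compact_unit_interval : compact [set: unit_interval R].
Proof.
rewrite -clamp_segment; apply: continuous_compact; last exact: segment_compact.
exact/continuous_subspaceT/continuous_clamp.
Qed.

Lemma connected_unit_interval : connected [set: unit_interval R].
Proof.
rewrite -clamp_segment; apply: connected_continuous_connected.
  exact: segment_connected.
exact/continuous_subspaceT/continuous_clamp.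
Qed.

End Clamp.

(** * Currying and evaluation for path spaces *)

Section PathSpace.
Context {R : realType}.

Definition path_of (Y : topologicalType) (f : unit_interval R -> Y)
    (cf : continuous f) : path_space R Y :=
  (mkcts cf : continuousType (unit_interval R) Y).

Lemma continuous_into_path_space (X Y : topologicalType)
    (F : X -> path_space R Y) :
  continuous (fun z : X * unit_interval R => F z.1 z.2) -> continuous F.
Proof.
move=> cF; apply: continuous_comp_initial.
exact: (continuous_curry_fun cF).
Qed.

(** Evaluation is jointly continuous because the interval is locally compact and regular. *)
Lemma continuous_path_space_eval (Y : topologicalType) :
  continuous (fun z : path_space R Y * unit_interval R => z.1 z.2).
Proof.
have -> : (fun z : path_space R Y * unit_interval R => z.1 z.2) = @eval _ _.
  by apply/funext => -[].
apply: eval_continuous; last exact: uniform_regular.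
move=> t _; rewrite withinET; exists [set: unit_interval R].
  exact: filterT.
by split; [exact: compact_unit_interval|exact: closedT].
Qed.

Lemma continuous_path_space_app (X Y : topologicalType)
    (F : X -> path_space R Y) (g : X -> unit_interval R) :
  continuous F -> continuous g -> continuous (fun x => F x (g x)).
Proof.
move=> cF cg.
exact: (continuous_compose (continuous_pair cF cg)
                           (@continuous_path_space_eval Y)).
Qed.

End PathSpace.

(** * Path-lifting maps and lifts of constant paths *)

Section PathLifting.
Context {R : realType} {E B : topologicalType} (p : E -> B).
Local Notation I := (unit_interval R).
Local Notation Z := (lifting_data R p).

Definition lifting_datum (e : E) (g : path_space R B) (ge : g (I0 R) = p e) : Z :=
  exist _ (e, g) (mem_set (ge : lifting_data R p (e, g))).

Lemma continuous_lifting_datum (X : topologicalType) (f : X -> E)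
    (g : X -> path_space R B) (gf : forall x, g x (I0 R) = p (f x)) :
  continuous f -> continuous g -> continuous (fun x => lifting_datum (gf x)).
Proof.
by move=> cf cg; apply: continuous_comp_initial; exact: continuous_pair.
Qed.

Lemma continuous_start : continuous (fun z : Z => (set_val z).1).
Proof.
exact: (continuous_compose (@initial_continuous _ _ _) (@continuous_fst _ _)).
Qed.

Lemma continuous_path : continuous (fun z : Z => (set_val z).2).
Proof.
exact: (continuous_compose (@initial_continuous _ _ _) (@continuous_snd _ _)).
Qed.

(** Applying a path-lifting map to these data gives a vertical homotopy starting at the identity. *)
Definition const_datum (e : E) : Z :=
  @lifting_datum e (cst (p e) : continuousType I B) erefl.

Lemma continuous_const_datum : continuous p -> continuous const_datum.
Proof.
move=> cp; apply: continuous_lifting_datum; first by move=> e; exact: cvg_id.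
apply: continuous_into_path_space.
exact: (continuous_compose (@continuous_fst _ _) cp).
Qed.

(** Reduces regularity to the data [const_datum e]. *)
Lemma const_datumE (z : Z) : (set_val z).2 = cst (p (set_val z).1) :> (I -> B) ->
  z = const_datum (set_val z).1.
Proof.
move=> zc; apply: val_inj => /=; rewrite [LHS]surjective_pairing; congr pair.
by apply/continuousEP => t; rewrite zc.
Qed.

(** This is the universal lifting problem: the test space is [Z] itself, the homotopy is evaluation
    of the path, and the lift is then curried. *)
Lemma hurewicz_path_lifting_map :
  hurewicz_fibration R p -> exists L : Z -> path_space R E, path_lifting_map L.
Proof.
move=> [_ /(_ Z (fun z => (set_val z).1) (fun zt => (set_val zt.1).2 zt.2))].
case=> [||z|G [cG G0 pG]]; first exact: continuous_start.
- apply: (@continuous_path_space_app _ _ _ (fun zt => (set_val zt.1).2) snd).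
    exact: (continuous_compose (@continuous_fst _ _) continuous_path).
  exact: continuous_snd.
- exact: (set_valP z).
have cGz z : continuous (fun t => G (z, t)) := continuous_section cG.
exists (fun z => path_of (cGz z)); split; last first.
  by move=> z; split; [exact: G0|apply/funext => t; exact: pG].
apply: continuous_into_path_space.
by rewrite (_ : (fun _ => _) = G)//; apply/funext => -[].
Qed.

Section VerticalHomotopy.
Hypotheses (finE : finite_set [set: E]) (T0E : kolmogorov_space E).
Hypothesis cp : continuous p.
Variable L : Z -> path_space R E.
Hypothesis pL : path_lifting_map L.

Let h (t : I) (e : E) : E := L (const_datum e) t.

Let ch t : continuous (h t).
Proof.
apply: (@continuous_path_space_app R _ _ (L \o const_datum) (cst t)).
  exact: (continuous_compose (continuous_const_datum cp) pL.1).
exact: cst_continuous.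
Qed.

Let ch' e : continuous (h ^~ e).
Proof. exact: cts_fun. Qed.

Let ph t e : p (h t e) = p e.
Proof. by case: pL => _ /(_ (const_datum e))[_ /(congr1 (@^~ t))]. Qed.

Let h0 : h (I0 R) = id.
Proof. by apply/funext => e; case: pL => _ /(_ (const_datum e))[]. Qed.

Lemma open_const_lift : (forall e, ~ map_down_beat_point p e) ->
  open [set t | h t = id].
Proof. exact: (open_vertical_id finE T0E ch ch' ph). Qed.

Lemma minimal_regular_lifting : minimal_map p -> regular_lifting L.
Proof.
move=> minp z /const_datumE ->; apply/funext => t.
have hT : [set t | h t = id] = [set: I].
  apply: connected_unit_interval; first by exists (I0 R).
    exists [set t | h t = id]; rewrite ?setTI//; apply: open_const_lift => e.
    by move=> be; apply: (minp e); left.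
  exists [set t | h t = id]; rewrite ?setTI//.
  apply: (closed_vertical_id finE T0E ch ch' ph) => e be.
  by apply: (minp e); right.
have : [set t | h t = id] t by rewrite hT.
by move=> /(congr1 (@^~ (set_val z).1)).
Qed.

(** A single [a] works for all [e] because the open set of times concerns the whole map [h t]. *)
Lemma initially_const_lift : (forall e, ~ map_down_beat_point p e) ->
  exists2 a : R, 0 < a &
    forall e (t : I), set_val t <= a -> L (const_datum e) t = e.
Proof.
move=> /open_const_lift; rewrite openE => /(_ (I0 R) h0) /= nid.
have : \forall s \near (0 : R), h (clamp s) = id.
  have : nbhs (clamp 0) [set t | h t = id].
    by rewrite (_ : clamp 0 = I0 R)// -[RHS]set_valK.
  exact: (@continuous_clamp R 0 [set t | h t = id]).
(* The radius is halved since the ball is open while the bound on [t] is not strict. *)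
move=> /nbhs_ballP[a /= a0 ha]; exists (a / 2); first by rewrite divr_gt0.
move=> e t ta; have /andP[t0 _] := unit_interval_val t.
rewrite -[t]set_valK; have := ha (set_val t).
rewrite /ball/= sub0r normrN ger0_norm// => /(_ _)/(congr1 (@^~ e)); apply.
by apply: le_lt_trans ta _; lra.
Qed.

End VerticalHomotopy.

(** * Restarting a lifting and doubling the time of constancy *)

Section Restart.
Variable L : Z -> path_space R E.
Hypothesis pL : path_lifting_map L.

Let cL : continuous L. Proof. by case: pL. Qed.

Let L0 z : L z (I0 R) = (set_val z).1.
Proof. by case: pL => _ /(_ z)[]. Qed.

Let LP z t : p (L z t) = (set_val z).2 t.
Proof. by case: pL => _ /(_ z)[_ /(congr1 (@^~ t))]. Qed.

Lemma continuous_shift :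
  continuous (fun st : I * I => clamp (set_val st.1 + set_val st.2)).
Proof.
apply: (@continuous_compose _ _ _ (fun st : I * I => set_val st.1 + set_val st.2));
  last exact: continuous_clamp.
move=> st; apply: (@continuousD _ R^o (I * I)%type (set_val \o fst) (set_val \o snd)).
  exact: (continuous_compose (@continuous_fst _ _) (@initial_continuous _ _ _)).
exact: (continuous_compose (@continuous_snd _ _) (@initial_continuous _ _ _)).
Qed.

Lemma continuous_shift_path (g : path_space R B) (s : I) :
  continuous (fun t : I => g (clamp (set_val s + set_val t))).
Proof.
exact: (continuous_compose (continuous_section continuous_shift) (@cts_fun _ _ g)).
Qed.

(** The tail of [g] from time [s] on; owing to [clamp] it rests at the endpoint of [g] once [s + t]
    exceeds 1. *)
Definition shift_path (g : path_space R B) (s : I) : path_space R B :=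
  path_of (@continuous_shift_path g s).

Lemma shift_path_start z s :
  shift_path (set_val z).2 s (I0 R) = p (L z s).
Proof.
rewrite LP -[in RHS](set_valK s); congr (_ (clamp _)); exact: addr0.
Qed.

Definition restart (zs : Z * I) : Z := lifting_datum (shift_path_start zs.1 zs.2).

Lemma continuous_restart : continuous restart.
Proof.
apply: (@continuous_lifting_datum _ (fun zs => L zs.1 zs.2)
  (fun zs => shift_path (set_val zs.1).2 zs.2)).
  exact: (continuous_path_space_app
    (continuous_compose (@continuous_fst _ _) cL) (@continuous_snd _ _)).
apply: continuous_into_path_space.
have cpath : continuous (fun zst : (Z * I) * I => (set_val zst.1.1).2).
  exact: (continuous_compose
    (continuous_compose (@continuous_fst _ _) (@continuous_fst _ _))
    continuous_path).
have ctime : continuous (fun zst : (Z * I) * I => (zst.1.2, zst.2)).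
  apply: continuous_pair; last exact: continuous_snd.
  exact: (continuous_compose (@continuous_fst _ _) (@continuous_snd _ _)).
exact: (continuous_path_space_app cpath (continuous_compose ctime continuous_shift)).
Qed.

Variable a : R.
Hypothesis a_ge0 : 0 <= a.

(** Time is split as [t = min(t, a) + max(t - a, 0)]: the lifting is restarted at time [before t]
    and then followed for time [after t]. *)
Let before (t : I) : I := clamp (Num.min (set_val t) a).
Let after (t : I) : I := clamp (set_val t - a).

Let continuous_before : continuous before.
Proof.
apply: (@continuous_compose _ _ _ (fun t : I => Num.min (set_val t) a));
  last exact: continuous_clamp.
move=> t; apply: (@continuous_min R _ set_val (cst a)).
  exact: initial_continuous.
exact: cst_continuous.
Qed.

Let continuous_after : continuous after.
Proof.
apply: (@continuous_compose _ _ _ (fun t : I => set_val t - a));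
  last exact: continuous_clamp.
move=> t; apply: (@continuousD _ R^o _ set_val (cst (- a))).
  exact: initial_continuous.
exact: cst_continuous.
Qed.

(* For [t <= a] this is [L z t], since [after t] is then [0]; the uniform formula
   makes continuity immediate, without pasting at [t = a]. *)
Definition restart_lift (zt : Z * I) : E :=
  L (restart (zt.1, before zt.2)) (after zt.2).

Lemma continuous_restart_lift : continuous restart_lift.
Proof.
apply: (@continuous_path_space_app _ _ _
  (fun zt => L (restart (zt.1, before zt.2))) (fun zt => after zt.2)).
  apply: (@continuous_compose _ _ _ (fun zt => restart (zt.1, before zt.2)));
    last exact: cL.
  apply: (@continuous_compose _ _ _ (fun zt : Z * I => (zt.1, before zt.2)));
    last exact: continuous_restart.
  apply: continuous_pair; first exact: continuous_fst.
  exact: (continuous_compose (@continuous_snd _ _) continuous_before).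
exact: (continuous_compose (@continuous_snd _ _) continuous_after).
Qed.

Let before_after t : set_val (before t) + set_val (after t) = set_val t.
Proof.
rewrite !set_val_clamp; have /andP[t0 t1] := unit_interval_val t.
case: (leP (set_val t) a) => ta.
  rewrite (min_idPl t1) (max_idPr t0) (max_idPl _) ?addr0//.
  by rewrite ge_min subr_le0 ta.
rewrite (min_idPl (ltW (lt_le_trans ta t1))) (max_idPr a_ge0).
have ta1 : set_val t - a <= 1 by apply: le_trans t1; rewrite gerBl.
by rewrite (min_idPl ta1) (max_idPr _) ?subr_ge0 1?ltW// addrC subrK.
Qed.

Let before0 : before (I0 R) = I0 R.
Proof. by apply: clamp_le0; rewrite ge_min lexx. Qed.

Let after0 : after (I0 R) = I0 R.
Proof. by apply: clamp_le0; rewrite subr_le0. Qed.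

Lemma double_const_lift :
  (forall e (t : I), set_val t <= a -> L (const_datum e) t = e) ->
  exists2 L' : Z -> path_space R E, path_lifting_map L' &
    forall e (t : I), set_val t <= a + a -> L' (const_datum e) t = e.
Proof.
move=> Lconst.
have cR z : continuous (fun t => restart_lift (z, t)) :=
  continuous_section continuous_restart_lift.
exists (fun z => path_of (cR z)).
  split.
    apply: continuous_into_path_space.
    rewrite (_ : (fun _ => _) = restart_lift); last by apply/funext => -[].
    exact: continuous_restart_lift.
  move=> z; split; last first.
    (* The restarted lift lies over the path at time [before t + after t], which is [t]. *)
    apply/funext => t; rewrite /= /restart_lift LP /=.
    congr ((set_val z).2 _); rewrite -[RHS]set_valK; congr clamp.
    exact: before_after.
  rewrite [LHS]/(restart_lift (z, I0 R)) /restart_lift/= after0 L0 /=.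
  by rewrite before0 L0.
move=> e t ta; rewrite [LHS]/(restart_lift (const_datum e, t)) /restart_lift/=.
have before_le : set_val (before t) <= a.
  by rewrite set_val_clamp ge_max a_ge0 !ge_min lexx orbT.
have after_le : set_val (after t) <= a.
  by rewrite set_val_clamp ge_max a_ge0 !ge_min lerBlDr ta.
(* Up to [before t] the lift stays at [e], and a shifted constant path is constant, so the restarted
   datum is [const_datum e] again. *)
have := @const_datumE (restart (const_datum e, before t)).
by rewrite /= Lconst// => -> //; exact: Lconst.
Qed.

End Restart.

End PathLifting.

Theorem theorem6p12 (R : realType) (E B : topologicalType) (p : E -> B) :
  finite_T0_space E -> finite_T0_space B -> [set: E] !=set0 ->
  hurewicz_fibration R p ->
  (minimal_map p ->
     forall L : lifting_data R p -> path_space R E,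
       path_lifting_map L -> regular_lifting L) /\
  ((forall e : E, ~ map_down_beat_point p e) ->
     exists L : lifting_data R p -> path_space R E,
       path_lifting_map L /\ regular_lifting L).
Proof.
move=> [finE T0E] _ _ hp; have [cp _] := hp.
split=> [minp L pL|ndbp]; first exact: minimal_regular_lifting.
have [L pL] := hurewicz_path_lifting_map hp.
have [a a0 La] := initially_const_lift finE T0E cp pL ndbp.
have [n Ln] : exists n : nat, 1 <= a *+ (2 ^ n).
  (* For this [n], [a^-1 < 2 ^ n], so [n] doublings of [a] cover the interval. *)
  exists (Num.bound a^-1).
  rewrite -mulr_natr natrX -ler_pdivrMl// mulr1.
  exact/ltW/upper_nthrootP.
(* Each doubling changes the lifting map, so the induction carries only its existence. *)
have : exists2 L : lifting_data R p -> path_space R E, path_lifting_map L &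
    forall e (t : unit_interval R), set_val t <= a *+ (2 ^ n) ->
      L (const_datum p e) t = e.
  elim: {Ln} n => [|n [L' pL' L'n]]; first by exists L.
  rewrite expnS mul2n -addnn mulrnDr.
  by apply: double_const_lift L'n => //; rewrite mulrn_wge0// ltW.
move=> [L' pL' L'1]; exists L'; split=> // z /const_datumE ->.
apply/funext => t; apply: L'1; apply: le_trans Ln.
by have /andP[] := unit_interval_val t.
Qed.
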